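(* Let $m\ge 2$, $n\ge 1$ be integers and let $\mathcal{A}\in\mathbb{T}_{m,n}$ be a ${\rm Z}^+$-tensor. Then for every $b\in\mathbb{R}^n$ the system of tensor equations $\mathcal{A}x^{m-1}=b$ has a solution $x\in\mathbb{R}^n$.
   Context: $\mathbb{T}_{m,n}$ denotes the set of all $m$-th order $n$-dimensional square real tensors $\mathcal{A}=(a_{i_1i_2\cdots i_m})$, $i_1,\ldots,i_m\in\{1,\ldots,n\}$. For $\mathcal{A}\in\mathbb{T}_{m,n}$ and $x\in\mathbb{R}^n$, $\mathcal{A}x^{m-1}\in\mathbb{R}^n$ is the vector with components $(\mathcal{A}x^{m-1})_i=\sum_{i_2,\ldots,i_m=1}^n a_{ii_2\cdots i_m}x_{i_2}\cdots x_{i_m}$, $i=1,\ldots,n$. A tensor $\mathcal{A}\in\mathbb{T}_{m,n}$ is a ${\rm Z}^+$-tensor if there exists no pair $(x,t)\in(\mathbb{R}^n\setminus\{0\})\times\mathbb{R}_+$ (with $\mathbb{R}_+=[0,\infty)$) such that $\mathcal{A}x^{m-1}+tx=0$. *)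

(* Defs.v *)
From HB Require Import structures.
From mathcomp Require Import all_boot all_order all_algebra.
From mathcomp Require Import reals.

Set Implicit Arguments.
Unset Strict Implicit.
Unset Printing Implicit Defensive.

Import Order.TTheory GRing.Theory Num.Theory.

Local Open Scope ring_scope.

(* The entry a_{i_1 ... i_m} is A [tuple i_1; ...; i_m]. *)
Definition tensor (R : realType) (m n : nat) : Type :=
  {ffun m.-tuple 'I_n -> R}.

(* Summing over all index tuples whose first index is i avoids a cast between
   m and m.-1.+1; [tensor_applyE] gives the sum over (i_2, ..., i_m). The value
   is the zero vector in the degenerate case m = 0. *)
Definition tensor_apply (R : realType) (m n : nat)
    (A : tensor R m n) (x : 'cV[R]_n) : 'cV[R]_n :=
  \col_(i < n) \sum_(s : m.-tuple 'I_n | ohead s == Some i)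
     A s * \prod_(j <- behead s) x j 0.

Lemma tensor_applyE (R : realType) (m n : nat)
    (A : tensor R m.+1 n) (x : 'cV[R]_n) (i : 'I_n) :
  tensor_apply A x i 0 =
  \sum_(s : m.-tuple 'I_n) A [tuple of i :: s] * \prod_(k < m) x (tnth s k) 0.
Proof.
rewrite mxE (reindex_onto (fun s : m.-tuple 'I_n => [tuple of i :: s])
  (fun s : m.+1.-tuple 'I_n => [tuple of behead s])) /=; last first.
  by case/tupleP=> j s /= /eqP[->]; apply/val_inj.
apply: eq_big => [s|s _] /=.
  by rewrite eqxx; apply/eqP/val_inj.
by rewrite big_tuple.
Qed.

Definition Zplus_tensor (R : realType) (m n : nat) (A : tensor R m n) : Prop :=
  ~ exists (x : 'cV[R]_n) (t : R),
      [/\ x != 0, 0 <= t & tensor_apply A x + t *: x = 0].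

(* Main.v *)
Require Import Defs.
From mathcomp Require Import all_boot all_order all_fingroup all_algebra.
From mathcomp Require Import zify ring lra.
From mathcomp Require Import mathcomp_extra boolp classical_sets reals.
From mathcomp Require Import interval_inference topology normedtype derive.

Set Implicit Arguments.
Unset Strict Implicit.
Unset Printing Implicit Defensive.

Import Order.TTheory GRing.Theory Num.Theory.
Import numFieldNormedType.Exports.

Local Open Scope ring_scope.

(* By homogeneity it is enough to solve [F y = e b] for some small [e > 0],
   where [F y] is [A y^(m-1)].  Put [G = F - e b], let [|.|] be the l1-norm and
   apply the Poincare-Miranda theorem to [G y + |G y| y] on the cube
   [-1, 1]^n.  At the zero [y] that it yields, either [G y = 0], or [|y| = 1]
   and then [F y + |F y| y] has norm at most [2 e |b|].  The Z+ property and
   compactness of the l1-sphere bound this norm from below by a positive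
   constant, which excludes the second case for small [e].

   Poincare-Miranda follows from Kuhn's cubical Sperner lemma.  The latter is
   proved with 0/1-valued functions [f_j] on the grid: the sum over all
   simplices of the Kuhn triangulation of the cup product of the coboundaries
   of the [f_j] depends mod 2 only on the boundary values, so it is the same as
   for [f_j x = (x_j == p)], where it is 1.  A simplex that contributes to the
   sum has, for each [j], an edge on which [f_j] changes. *)

(** * Kuhn's lemma *)

Section CupProduct.
Variables (R : comNzRingType) (n p : nat).
Hypothesis char2 : forall x : R, x + x = 0.

Local Notation vertex := {ffun 'I_n -> nat}.
Implicit Types (a : 'I_n -> vertex -> R) (k : 'I_n) (v w : nat -> vertex).
Implicit Types (q : {ffun 'I_n -> 'I_p}) (t : 'S_n).

(** A product is additive in each factor; this drives both the telescoping and the change of a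
    single label. *)
Lemma prod_add_factor (F G H : 'I_n -> R) (j0 : 'I_n) :
  (forall j, j != j0 -> F j = G j /\ F j = H j) -> F j0 = G j0 + H j0 ->
  \prod_j F j = \prod_j G j + \prod_j H j.
Proof.
move=> eqF eqF0; rewrite (bigD1 j0) //= (bigD1 (F := G) j0) //=.
rewrite (bigD1 (F := H) j0) //= eqF0 mulrDl.
by congr (_ * _ + _ * _); apply: eq_bigr => j /eqF[].
Qed.

(* The cup product of the coboundaries of the [a j], on the simplex
   [v 0, ..., v n]; signs are irrelevant in characteristic 2. *)
Definition cup_term a v : R := \prod_(j < n) (a j (v j.+1) + a j (v j)).

(* The cup product in which the [k]-th factor is [a k] itself instead of its
   coboundary, on the simplex [w 0, ..., w n.-1].  Its coboundary is
   [cup_term a]. *)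
Definition primitive a k w : R :=
  \prod_(j < n) (if (j < k)%N then a j (w j.+1) + a j (w j)
           else if j == k then a j (w j) else a j (w j) + a j (w j.-1)).

Definition facet (i : nat) v : nat -> vertex := fun l => v (bump i l).

(* The value of [primitive a k] on the [i]-th facet is the sum of two
   consecutive terms of this sequence, or a single one for [i = 0] and [i = n],
   so that the sum over all facets telescopes. *)
Let telescope_term a k v (i : nat) : R :=
  \prod_(j < n) (if (j < k)%N
           then a j (v (j + (i <= j)).+1%N) + a j (v (j + (i <= j))%N)
           else if j == k then a j (v (j + (i <= j))%N)
           else a j (v (j + (i <= j))%N) + a j (v (j + (i <= j)).-1%N)).

Let ord_neq (i j : 'I_n) : j != i -> j <> i :> nat.
Proof. by move=> /eqP ji e; apply/ji/val_inj. Qed.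

Lemma primitive_facet0 a k v : primitive a k (facet 0 v) = telescope_term a k v 0.
Proof.
apply: eq_bigr => j _; rewrite /facet /bump /= !add1n addn1 /=.
case: ifP => // jk; case: ifP => // /negbT/ord_neq jk'.
by congr (a j (v _) + a j (v _)); lia.
Qed.

Lemma primitive_facetn a k v : primitive a k (facet n v) = telescope_term a k v n.
Proof.
apply: eq_bigr => j _; rewrite /facet /bump /=.
have := ltn_ord j; have := ltn_ord k.
case: ifP => [jk kn jn|jk kn jn].
  by congr (a j (v _) + a j (v _)); lia.
case: ifP => [/eqP jk'|/negbT/ord_neq jk'].
  by congr (a j (v _)); rewrite jk'; lia.
by congr (a j (v _) + a j (v _)); lia.
Qed.

(** Omitting vertex [i.+1] merges two edges; the coboundary along the merged edge is the sum of
    those along the two. *)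
Lemma primitive_facet_le a k v i : (i < k)%N ->
  primitive a k (facet i.+1 v) = telescope_term a k v i + telescope_term a k v i.+1.
Proof.
move=> ik; have i_n : (i < n)%N by apply: ltn_trans ik (ltn_ord k).
apply: (prod_add_factor (j0 := Ordinal i_n)) => [j /ord_neq /= ji|];
  rewrite /facet /bump /=.
  case: ifP => jk; last case: ifP => [/eqP jk'|/negbT/ord_neq jk'].
  - by split; congr (a j (v _) + a j (v _)); lia.
  - by split; congr (a j (v _)); rewrite jk' in ji jk *; lia.
  - by split; congr (a j (v _) + a j (v _)); lia.
rewrite ik !leqnn !ltnn /= !addn0 !addn1 add1n add0n.
by rewrite -addrA [X in _ = _ + X]addrA char2 add0r.
Qed.

Lemma primitive_facet_gt a k v i : (k < i < n)%N ->
  primitive a k (facet i v) = telescope_term a k v i + telescope_term a k v i.+1.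
Proof.
case/andP=> ki i_n.
apply: (prod_add_factor (j0 := Ordinal i_n)) => [j /ord_neq /= ji|];
  rewrite /facet /bump /=.
  case: ifP => jk; last case: ifP => [/eqP jk'|/negbT/ord_neq jk'].
  - by split; congr (a j (v _) + a j (v _)); lia.
  - by split; congr (a j (v _)); rewrite jk' in ji jk *; lia.
  - by split; congr (a j (v _) + a j (v _)); lia.
rewrite ltnNge (ltnW ki) /= -val_eqE gtn_eqF //= !leqnn !ltnn.
case: i ki i_n => // i ki i_n; rewrite /= ltnn !addn0 !addn1 !add1n add0n.
by rewrite -addrA [X in _ = _ + X]addrA char2 add0r.
Qed.

Lemma cup_term_facets a k v :
  cup_term a v = \sum_(0 <= i < n.+1) primitive a k (facet i v).
Proof.
have sum_le m : (m <= k)%N ->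
    \sum_(0 <= i < m.+1) primitive a k (facet i v) = telescope_term a k v m.
  elim: m => [|m IHm] mk; first by rewrite big_nat1 primitive_facet0.
  by rewrite big_nat_recr //= IHm 1?ltnW // primitive_facet_le // addrA char2 add0r.
have sum_gt m : (k < m <= n)%N ->
    \sum_(k.+1 <= i < m) primitive a k (facet i v) =
    telescope_term a k v k.+1 + telescope_term a k v m.
  elim: m => // m IHm /andP[]; rewrite ltnS leq_eqVlt => /predU1P[<- _|km mn].
    by rewrite big_geq // char2.
  rewrite big_nat_recr //= IHm ?km 1?ltnW // primitive_facet_gt ?km //.
  by rewrite -addrA [X in _ + X]addrA char2 add0r.
have kn := ltn_ord k.
rewrite (big_cat_nat (n := k.+1)) ?(leqW kn) //= sum_le //.
rewrite big_nat_recr //= sum_gt ?kn ?leqnn //.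
rewrite primitive_facetn -addrA char2 addr0.
(* The remaining terms [k] and [k.+1] differ only in factor [k], which is [a k] at either end of the
   [k]-th edge. *)
apply: (prod_add_factor (j0 := k)) => [j /ord_neq jk|]; last first.
  by rewrite /= !ltnn eqxx leqnn addn0 addn1.
case: ifP => jk'; last case: ifP => [/eqP/(congr1 val)//|_].
  by split; congr (a j (v _) + a j (v _)); lia.
by split; congr (a j (v _) + a j (v _)); lia.
Qed.

(* The [i]-th vertex of a Kuhn simplex: from the corner [q], the step in
   direction [j] is the [t j]-th one. *)
Definition path_vertex q t (i : nat) : vertex := [ffun j => q j + (t j < i)]%N.

Lemma eq_primitive a k w w' :
  (forall l, (l < n)%N -> w l = w' l) -> primitive a k w = primitive a k w'.
Proof.
move=> eqw; apply: eq_bigr => j _; rewrite (eqw j) // (eqw j.-1); last first.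
  exact: leq_ltn_trans (leq_pred _) (ltn_ord j).
by case: ifP => // jk; rewrite eqw // (leq_ltn_trans jk).
Qed.

(* Each interior facet lies in two simplices of the cube, related by a
   transposition. *)
Lemma sum_interior_facet a k q i : (0 < i < n)%N ->
  \sum_t primitive a k (facet i (path_vertex q t)) = 0.
Proof.
case: i => // i i_n; have i_n' := ltnW i_n.
(* Swapping the steps [i] and [i.+1] moves only the omitted vertex [i.+1]; parity picks one
   permutation of each pair. *)
pose s : 'S_n := tperm (Ordinal i_n') (Ordinal i_n).
have odd_s : odd_perm s by rewrite odd_tperm -val_eqE /= neq_ltn ltnSn.
rewrite (bigID (fun t : 'S_n => odd_perm t)) /=.
rewrite (reindex_inj (mulIg s)) /=.
rewrite [X in X + _](eq_big (fun t : 'S_n => ~~ odd_perm t)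
  (fun t => primitive a k (facet i.+1 (path_vertex q t)))) ?char2 //.
  by move=> t; rewrite odd_permM odd_s addbT.
move=> t _; apply: eq_primitive => l _; apply/ffunP => j; rewrite !ffunE permM.
have := neq_bump i.+1 l; move: (bump _ _) => m im; congr (_ + nat_of_bool _)%N.
by case: tpermP => [->|->|] //=; lia.
Qed.

Definition cup a : R :=
  \sum_(q : {ffun 'I_n -> 'I_p}) \sum_t cup_term a (path_vertex q t).

(* The facet opposite to the first vertex is, up to a cyclic shift of the
   directions, the facet opposite to the last vertex in the neighbouring cube;
   at the boundary of the grid both contributions vanish. *)
Lemma sum_outer_facets a k :
  (forall w (d : 'I_n) b, b \in [:: 0%N; p] ->
     (forall l, (l < n)%N -> w l d = b) ->
     primitive a k w = 0) ->
  \sum_q \sum_t primitive a k (facet 0 (path_vertex q t)) =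
  \sum_q \sum_t primitive a k (facet n (path_vertex q t)).
Proof.
have n_gt0 : (0 < n)%N := leq_ltn_trans (leq0n k) (ltn_ord k).
move=> prim0; rewrite exchange_big [RHS]exchange_big /=.
(* Composing [t] with [c] makes its first step, in direction [d], the last one. *)
pose c : 'S_n := perm (can_inj (@ord_predK n)).
have cE i : c i = ord_pred i by rewrite permE.
rewrite [RHS](reindex_inj (mulIg c)); apply: eq_bigr => t _ /=.
pose d := (t^-1)%g (Ordinal n_gt0).
have td : t d = Ordinal n_gt0 by rewrite permKV.
have t_d j : j != d -> (0 < t j)%N.
  rewrite lt0n; apply: contra => /eqP tj.
  by apply/eqP/(@perm_inj _ t)/val_inj; rewrite td.
pose sh q : {ffun 'I_n -> 'I_p} := [ffun j => if j == d then ordS (q j) else q j].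
have sh_inj : injective sh.
  move=> q q' /ffunP eqq; apply/ffunP => j; have := eqq j; rewrite !ffunE.
  by case: ifP => // _ /(can_inj (@ordSK p)).
rewrite [RHS](reindex_inj sh_inj); apply: eq_bigr => q _ /=.
have [qd|qd] := ltnP (q d).+1 p.
  apply: eq_primitive => l ln; apply/ffunP => j; rewrite !ffunE permM cE.
  rewrite /bump /= (leqNgt n) ln add0n add1n; case: eqP => [->|/eqP/t_d tj].
    by rewrite td /= (modn_small qd) modn_small ?addn0; lia.
  congr (_ + nat_of_bool _)%N.
  rewrite /= -(prednK tj) addSn /= addnC modnDl modn_small ?ltnS //.
  by rewrite (leq_ltn_trans (leq_pred _)).
(* Here [sh] wraps around: one facet lies in the face where coordinate [d] is [p], the other where
   it is 0. *)
have qdp : (q d).+1 = p by apply/eqP; rewrite eqn_leq qd ltn_ord.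
rewrite (prim0 _ d p) ?inE ?eqxx ?orbT // => [|l _]; last first.
  by rewrite !ffunE td /= addn1.
rewrite (prim0 _ d 0%N) ?inE ?eqxx // => l ln.
rewrite !ffunE eqxx permM cE td /= qdp modnn /bump (leqNgt n) ln add0n modn_small; lia.
Qed.

(** On a face of direction [d], factor [d] of the primitive vanishes: it is [a k] if [d = k], and
    otherwise the coboundary of a function constant on that face. All other facets cancel. *)
Lemma cup_eq0 a k :
  (forall x : vertex, x k \in [:: 0%N; p] -> a k x = 0) ->
  (forall j (x y : vertex), j != k -> x j = y j -> x j \in [:: 0%N; p] -> a j x = a j y) ->
  cup a = 0.
Proof.
move=> ak0 ajE; rewrite /cup.
have n_gt0 : (0 < n)%N := leq_ltn_trans (leq0n k) (ltn_ord k).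
transitivity (\sum_(0 <= i < n.+1) \sum_q \sum_t primitive a k (facet i (path_vertex q t))).
  rewrite [RHS]exchange_big; apply: eq_bigr => q _.
  by rewrite [RHS]exchange_big; apply: eq_bigr => t _; apply: cup_term_facets.
rewrite big_nat_recr // big_ltn //= sum_outer_facets => [|w d b b0p wd]; last first.
  have [dk|dk|/val_inj dk] := ltngtP d k; rewrite /primitive (bigD1 d) //=.
  - have dn : (d.+1 < n)%N by rewrite (leq_ltn_trans dk).
    rewrite dk (ajE d (w d.+1) (w d)) ?(wd _ dn) ?(wd _ (ltn_ord d)) // ?char2 ?mul0r //.
    by rewrite -val_eqE ltn_eqF.
  - have dn : (d.-1 < n)%N by rewrite (leq_ltn_trans (leq_pred _)).
    rewrite [(d < k)%N]ltnNge (ltnW dk) /= -val_eqE gtn_eqF //.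
    rewrite (ajE d (w d) (w d.-1)) ?(wd _ dn) ?(wd _ (ltn_ord d)) // ?char2 ?mul0r //.
    by rewrite -val_eqE gtn_eqF.
  - by rewrite dk ltnn eqxx ak0 ?mul0r // -dk wd.
rewrite addrAC char2 add0r.
rewrite big_nat big1 // => i /andP[i0 i_n]; rewrite big1 // => q _.
by apply: sum_interior_facet; rewrite i0.
Qed.

(** By multilinearity the difference is the cup product with [a k + a' k] as [k]-th label, to which
    [cup_eq0] applies. *)
Lemma cup_congr_label a a' k :
  (forall j, j != k -> a j =1 a' j) ->
  (forall x : vertex, x k \in [:: 0%N; p] -> a k x = a' k x) ->
  (forall j (x y : vertex), x j = y j -> x j \in [:: 0%N; p] -> a j x = a j y) ->
  cup a = cup a'.
Proof.
move=> eqa eqak aE; pose b j x := if j == k then a k x + a' k x else a j x.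
have -> : cup a' = cup b + cup a.
  rewrite -big_split; apply: eq_bigr => q _; rewrite -big_split; apply: eq_bigr => t _ /=.
  apply: (prod_add_factor (j0 := k)) => [j jk|]; rewrite /b.
    by rewrite (negPf jk) !eqa.
  by rewrite eqxx; ring: (char2 (a k (path_vertex q t k)))
   (char2 (a k (path_vertex q t k.+1))).
rewrite (cup_eq0 (a := b) (k := k)) ?add0r // /b.
  by move=> x xk; rewrite eqxx eqak ?char2.
by move=> j x y jk; rewrite (negPf jk); apply: aE.
Qed.

(** Factor [j] is nonzero only if step [j] goes in direction [j] from [p.-1] to [p]. This leaves the
    last cube and the identity permutation. *)
Lemma cup_coordinates : (0 < p)%N -> cup (fun j x => (x j == p)%:R) = 1.
Proof.
move=> p_gt0; have lp : (p.-1 < p)%N by rewrite prednK.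
rewrite /cup (bigD1 [ffun=> Ordinal lp]) //= (bigD1 1%g) //=.
rewrite {1}/cup_term big1 => [|j _]; last first.
  rewrite !ffunE perm1 /= ltnSn ltnn addn0 addn1 prednK // eqxx.
  by rewrite ltn_eqF // addr0.
have factor q t (j : 'I_n) : (((path_vertex q t j.+1) j == p)%:R +
   ((path_vertex q t j) j == p)%:R : R) = ((q j == p.-1 :> nat) && (t j == j))%:R.
  rewrite !ffunE -[t j == j]val_eqE ltnS /=; have qp := ltn_ord (q j).
  case: (ltngtP (t j) j) => _; rewrite ?andbT ?andbF ?char2 //.
  by rewrite addn0 addn1 (ltn_eqF qp) addr0 -[in RHS]eqSS prednK.
rewrite big1 => [|t t1]; last first.
  have [j tj] : exists j, t j != j.
    by apply/existsP; rewrite -negb_forall; apply: contra t1 => /forallP t1;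
       apply/eqP/permP => j; rewrite perm1; apply/eqP.
  by rewrite /cup_term (bigD1 j) //= factor (negPf tj) andbF mul0r.
rewrite big1 ?addr0 // => q q1; apply: big1 => t _.
have [j qj] : exists j, q j != p.-1 :> nat.
  apply/existsP; rewrite -negb_forall; apply: contra q1 => /forallP q1.
  apply/eqP/ffunP => j; rewrite ffunE; apply: val_inj => /=.
  exact/eqP/q1.
by rewrite /cup_term (bigD1 j) //= factor (negPf qj) /= mul0r.
Qed.
End CupProduct.

Lemma kuhn n p (f : 'I_n -> {ffun 'I_n -> nat} -> bool) : (0 < p)%N ->
  (forall (j : 'I_n) (x : {ffun 'I_n -> nat}), x j = 0%N -> f j x = false) ->
  (forall (j : 'I_n) (x : {ffun 'I_n -> nat}), x j = p -> f j x = true) ->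
  exists q : {ffun 'I_n -> 'I_p}, forall b j, exists2 x : {ffun 'I_n -> nat},
    f j x = b & forall i, (q i <= x i <= (q i).+1)%N.
Proof.
move=> p_gt0 f0 fp; have char2 (x : 'F_2) : x + x = 0
  by rewrite addrr_pchar2 // pchar_Fp.
pose g (j : 'I_n) (x : {ffun 'I_n -> nat}) := x j == p.
(* Raising [m] from 0 to [n] replaces the labels [f j] by the coordinate labels one at a time. *)
pose h m (j : 'I_n) x : 'F_2 := (if (j < m)%N then g j x else f j x)%:R.
have eqfg j (x : {ffun 'I_n -> nat}) : x j \in [:: 0%N; p] -> f j x = g j x.
  rewrite !inE /g => /orP[] /eqP xj; first by rewrite f0 // xj eq_sym gtn_eqF.
  by rewrite fp // xj eqxx.
have cuph m : (m <= n)%N -> cup p (h m) = cup p (h 0%N).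
  elim: m => // m IHm mn; rewrite -IHm 1?ltnW //.
  apply: (@cup_congr_label _ _ p char2 _ _ (Ordinal mn)) => [j jm x|x xm|j x y xy xj].
  - by rewrite /h ltnS leq_eqVlt -(inj_eq val_inj) /= in jm *; rewrite (negPf jm).
  - by rewrite /h /= ltnn ltnSn eqfg.
  - rewrite /h; have yj : y j \in [:: 0%N; p] by rewrite -xy.
    by case: ifP => _; rewrite ?eqfg // /g xy.
have cup1 : cup p (h 0%N) = 1.
  rewrite -(cuph n) // -(cup_coordinates n char2 p_gt0).
  apply: eq_bigr => q _; apply: eq_bigr => t _; apply: eq_bigr => j _.
  by rewrite /h ltn_ord.
have [q [t qt]] : exists q t, cup_term (h 0%N) (path_vertex (p := p) q t) != 0.
  have [/existsP[q /existsP[t qt]]|no] := boolP [exists q : {ffun 'I_n -> 'I_p},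
      [exists t, cup_term (h 0%N) (path_vertex q t) != 0]]; first by exists q, t.
  have := oner_neq0 'F_2; rewrite -cup1 /cup big1 ?eqxx // => q _; apply: big1 => t _.
  by apply/eqP; apply: contraNT no => qt; apply/existsP; exists q; apply/existsP; exists t.
exists q => b j; pose v i := path_vertex q t i.
have inq i l : (q l <= v i l <= (q l).+1)%N.
  by rewrite ffunE leq_addr /=; case: (t l < i)%N => /=; lia.
have : h 0%N j (v j.+1) + h 0%N j (v j) != 0.
  by apply: contra qt => /eqP fj; rewrite /cup_term (bigD1 j) //= fj mul0r.
rewrite /h ltn0.
have [<- _|] := eqVneq (f j (v j)) b; first by exists (v j).
have [<- _ _|] := eqVneq (f j (v j.+1)) b; first by exists (v j.+1).
by case: (f j (v j)) (f j (v j.+1)) b => [] [] []; rewrite //= ?char2 eqxx.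
Qed.

(** * The Poincare-Miranda theorem *)

Local Open Scope classical_set_scope.

Definition cube (R : realType) n : set 'rV[R]_n := [set x | forall j, -1 <= x 0 j <= 1].

Lemma cube_compact (R : realType) n : compact (@cube R n).
Proof.
have := @rV_compact R n (fun=> `[-1, 1]%classic) (fun=> @segment_compact R (-1) 1).
by rewrite (_ : mkset _ = @cube R n) //; apply/seteqP;
  split=> x /= x1 j; have := x1 j; rewrite /= in_itv.
Qed.

Lemma poincare_miranda (R : realType) n (g : 'I_n -> 'rV[R]_n -> R) :
  (forall j, continuous (g j)) ->
  (forall j x, cube x -> x 0 j = -1 -> g j x <= 0) ->
  (forall j x, cube x -> x 0 j = 1 -> 0 <= g j x) ->
  exists2 x, cube x & forall j, g j x = 0.
Proof.
move=> g_cont g_lo g_hi.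
pose pt p (x : {ffun 'I_n -> nat}) : 'rV[R]_n := \row_j (2 * (x j)%:R / p.+1%:R - 1).
have ptcube p (x : {ffun 'I_n -> nat}) : (forall j, x j <= p.+1)%N -> cube (pt p x).
  move=> xp j; rewrite mxE; have p0 : 0 < p.+1%:R :> R by rewrite ltr0n.
  rewrite lerBrDr lerBlDr addNr divr_ge0 ?mulr_ge0 ?ler0n //=.
  by rewrite ler_pdivrMr // ler_pM2l ?ltr0n // ler_nat.
pose brackets p c := cube c /\ forall j, exists y z,
  [/\ `|y - c| <= 2 / p.+1%:R, `|z - c| <= 2 / p.+1%:R, g j y <= 0 & 0 <= g j z].
have brackets_ex p : exists c, brackets p c.
  (* The label is the sign of [g j], overridden on the two faces of direction [j] to suit [kuhn];
     there [g_lo] and [g_hi] supply the weak sign. *)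
  pose f (j : 'I_n) (x : {ffun 'I_n -> nat}) :=
    (0 < x j)%N && ((x j == p.+1) || (0 < g j (pt p x))).
  have [j x xj|j x xj|q qP] := @kuhn n p.+1 f isT; rewrite /f ?xj ?eqxx //.
  pose x0 := [ffun i => nat_of_ord (q i)].
  have x0P i : x0 i = q i by rewrite ffunE.
  have close (x : {ffun 'I_n -> nat}) :
      (forall i, (q i <= x i <= (q i).+1)%N) -> `|pt p x - pt p x0| <= 2 / p.+1%:R.
    move=> qx; rewrite [leLHS]/Num.norm /= mx_normrE; apply: bigmax_le => // -[i j] _ /=.
    rewrite !mxE opprB addrA subrK -mulrBl -mulrBr x0P -natrB; last by have /andP[] := qx j.
    rewrite normrM normrM normr_nat normfV !normr_nat ler_pM2r ?invr_gt0 ?ltr0n //.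
    by rewrite ler_piMr // lern1 leq_subLR addn1; have /andP[] := qx j.
  have xp (x : {ffun 'I_n -> nat}) :
      (forall i, (q i <= x i <= (q i).+1)%N) -> forall j, (x j <= p.+1)%N.
    by move=> qx j; have /andP[_ /leq_trans] := qx j; apply; exact: ltn_ord.
  exists (pt p x0); split; first by apply: ptcube => j; rewrite x0P ltnW.
  move=> j.
  have [x /negbT fx qx] := qP false j; have [x' fx' qx'] := qP true j.
  exists (pt p x), (pt p x'); split; [exact: close|exact: close| |].
    move: fx; rewrite /f negb_and -leqNgt leqn0 negb_or -leNgt.
    case/orP => [/eqP xj|/andP[] //]; apply: g_lo; first exact/ptcube/xp.
    by rewrite mxE xj mulr0 mul0r add0r.
  move: fx' => /andP[_ /orP[/eqP xj|/ltW //]]; apply: g_hi; first exact/ptcube/xp.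
  by rewrite mxE xj mulfK // -[2]/(1 + 1) addrK.
have [c cP] := choice brackets_ex.
have [x [xcube xcl]] : @cube R n `&` cluster (c @ \oo) !=set0.
  by apply: cube_compact; exists 0%N => // p _; case: (cP p).
have key e : 0 < e -> exists p, `|x - c p| < e / 2 /\ 2 / p.+1%:R < e / 2.
  move=> e0; have e2 : 0 < e / 2 by rewrite divr_gt0.
  have /(xcl [set c p | p in [set p | 2 / p.+1%:R < e / 2]]) : nbhs x (ball x (e / 2)).
    exact: nbhsx_ballx.
  case=> [|_ [[p pe <-]]]; last by rewrite -ball_normE; exists p.
  have [N NE] : exists N : nat, 4 / e < N%:R.
    by exists (Num.bound (4 / e)); rewrite archi_boundP // divr_ge0 // ltW.
  exists N => // p /= Np; exists p => //=.
  rewrite ltr_pdivrMr ?ltr0n //; move: NE; rewrite ltr_pdivrMr // => NE.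
  have : N%:R <= p.+1%:R :> R by rewrite ler_nat ltnW.
  by nra.
(* Near [g j x] there are values of both weak signs, so [g j x] can be neither positive nor
   negative. *)
have sep j (P : set R) : nbhs (g j x) P ->
    exists y z, [/\ P (g j y), P (g j z), g j y <= 0 & 0 <= g j z].
  move=> /(g_cont j x) /nbhs_ballP[e /= e0 eP]; have [p [xp pe]] := key e e0.
  have [_ /(_ j)[y [z [yp zp gy gz]]]] := cP p; exists y, z.
  have xball u : `|u - c p| <= 2 / p.+1%:R -> P (g j u).
    move=> up; apply: eP; rewrite -ball_normE /=.
    rewrite -(subrKA (c p)) (le_lt_trans (ler_normD _ _)) // [ltRHS]splitr ltrD //.
    by rewrite distrC (le_lt_trans up).
  by split=> //; apply: xball.
exists x => // j; apply/eqP; rewrite eq_le; apply/andP; split; rewrite leNgt; apply/negP => gx.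
  by have [y [_ [+ _ + _]]] := sep j _ (lt_nbhsr gx); rewrite leNgt => /= ->.
by have [_ [z [_ + _ +]]] := sep j _ (lt_nbhsl gx); rewrite leNgt => /= ->.
Qed.

(** * Homogeneous maps *)

Lemma continuous_sum (R : realType) (T : topologicalType) (I : Type) (r : seq I)
    (P : pred I) (f : I -> T -> R) :
  (forall i, continuous (f i)) -> continuous (fun x => \sum_(i <- r | P i) f i x).
Proof.
by move=> fc x; apply: cvg_big => [|i _]; [exact: add_continuous|exact: fc].
Qed.

Lemma continuous_prod (R : realType) (T : topologicalType) (I : Type) (r : seq I)
    (P : pred I) (f : I -> T -> R) :
  (forall i, continuous (f i)) -> continuous (fun x => \prod_(i <- r | P i) f i x).
Proof.
by move=> fc x; apply: cvg_big => [|i _]; [exact: mul_continuous|exact: fc].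
Qed.

Definition ell1 (R : realType) n (u : 'I_n -> R) : R := \sum_i `|u i|.

Lemma ell1_ge0 (R : realType) n (u : 'I_n -> R) : 0 <= ell1 u.
Proof. exact: sumr_ge0. Qed.

Lemma ell1_eq0 (R : realType) n (u : 'I_n -> R) : ell1 u = 0 -> forall i, u i = 0.
Proof.
by move/eqP; rewrite psumr_eq0 // => /allP u0 i;
  apply/eqP; rewrite -normr_eq0; apply: u0; rewrite mem_index_enum.
Qed.

Lemma ell1D (R : realType) n (u v : 'I_n -> R) :
  ell1 (fun i => u i + v i) <= ell1 u + ell1 v.
Proof. by rewrite -big_split; apply: ler_sum => i _; apply: ler_normD. Qed.

Lemma ell1_dist (R : realType) n (u v : 'I_n -> R) :
  `|ell1 u - ell1 v| <= ell1 (fun i => u i - v i).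
Proof.
rewrite -sumrB; apply: le_trans (ler_norm_sum _ _ _) _.
by apply: ler_sum => i _; apply: ler_dist_dist.
Qed.

Lemma ell1Z (R : realType) n (c : R) (u : 'I_n -> R) :
  ell1 (fun i => c * u i) = `|c| * ell1 u.
Proof. by rewrite mulr_sumr; apply: eq_bigr => i _; rewrite normrM. Qed.

Lemma ell1_continuous (R : realType) (T : topologicalType) n (f : 'I_n -> T -> R) :
  (forall i, continuous (f i)) -> continuous (fun x => ell1 (f^~ x)).
Proof.
move=> fc; apply: continuous_sum => i x.
by apply: continuous_comp; [exact: fc|exact: norm_continuous].
Qed.

Section Homogeneous.
Variables (R : realType) (n k : nat) (F : 'I_n -> 'rV[R]_n -> R).
Hypothesis F_cont : forall i, continuous (F i).

Lemma solution_or_eigenvector (c : 'I_n -> R) :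
  (exists x, forall i, F i x = c i) \/
  exists2 x : 'rV[R]_n, ell1 (x 0) = 1 &
    forall i, F i x - c i + ell1 (fun l => F l x - c l) * x 0 i = 0.
Proof.
pose G i x := F i x - c i; pose M x := ell1 (G^~ x).
have G_cont i : continuous (G i).
  by move=> x; apply: (cvgB (@F_cont i x)); exact: cvg_cst.
have G_le i x : `|G i x| <= M x.
  by rewrite /M /ell1 (bigD1 i) //= lerDl sumr_ge0.
have [i x|i x _ xi|i x _ xi|x _ x0] :=
  @poincare_miranda R n (fun i x => G i x + M x * x 0 i).
- apply: (cvgD (G_cont i x)).
  by apply: cvgM; [exact: ell1_continuous|exact: coord_continuous].
- by rewrite xi mulrN1 subr_le0 (le_trans (ler_norm _)).
- by rewrite xi mulr1 -lerBlDl sub0r (le_trans (ler_norm _)) ?normrN.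
have [M0|M0] := eqVneq (M x) 0.
  by left; exists x => i; apply/eqP; rewrite -subr_eq0; apply/eqP/(ell1_eq0 M0).
(* Taking l1-norms in [G i x = - (M x * x 0 i)] gives [M x = M x * ell1 (x 0)]. *)
right; exists x => //; apply: (mulfI M0); rewrite mulr1.
rewrite -[X in X * _]ger0_norm ?ell1_ge0 // -ell1Z.
apply: eq_bigr => i _; rewrite -normrN; congr `|_|; apply/eqP.
by rewrite eqr_oppLR -addr_eq0 addrC x0.
Qed.

Hypothesis F_no_eigen : forall (x : 'rV[R]_n) (t : R), x != 0 -> 0 <= t ->
  ~ forall i, F i x + t * x 0 i = 0.

(** The minimum over the compact sphere is positive: a zero would be an eigenvector excluded by
    [F_no_eigen], with [t] the l1-norm of its image. *)
Lemma eigen_residue_gt0 : exists2 d : R, 0 < d & forall x : 'rV[R]_n,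
  ell1 (x 0) = 1 -> d <= ell1 (fun i => F i x + ell1 (F^~ x) * x 0 i).
Proof.
pose phi x := ell1 (fun i => F i x + ell1 (F^~ x) * x 0 i).
pose S := [set x : 'rV[R]_n | ell1 (x 0) = 1].
have phi_cont : continuous phi.
  apply: ell1_continuous => i x; apply: (cvgD (@F_cont i x)).
  by apply: cvgM; [exact: ell1_continuous|exact: coord_continuous].
have S_closed : closed S.
  apply: (@preimage_closed _ _ (fun x : 'rV[R]_n => ell1 (x 0)) [set 1]).
    by move=> x _; apply: ell1_continuous => i; exact: coord_continuous.
  exact: closed_eq.
have S_compact : compact S.
  apply: (subclosed_compact S_closed (@cube_compact R n)) => x Sx j.
  by rewrite -ler_norml -Sx /ell1 (bigD1 j) //= lerDl sumr_ge0.
(* The sphere is empty when [n = 0]; any positive bound then works. *)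
have [S0|S0] := pselect (S !=set0); last first.
  by exists 1 => // x Sx; case: S0; exists x.
have [|y + y_min] := compact_EVT_min S0 S_compact (f := phi).
  exact: continuous_subspaceT.
rewrite inE => Sy; exists (phi y) => [|x Sx]; last by apply: y_min; rewrite inE.
rewrite lt_def ell1_ge0 andbT; apply/eqP => phi0.
apply: (F_no_eigen (x := y) (t := ell1 (F^~ y))); last exact: ell1_eq0.
  apply/eqP => y0; move: Sy; rewrite /S /= y0 /ell1 big1 => [/eqP|i _].
    by rewrite eq_sym oner_eq0.
  by rewrite mxE normr0.
exact: ell1_ge0.
Qed.

Hypothesis k_gt0 : (0 < k)%N.
Hypothesis F_homog : forall (c : R) x i, F i (c *: x) = c ^+ k * F i x.

Lemma homogeneous_surjective (b : 'I_n -> R) : exists x, forall i, F i x = b i.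
Proof.
have [d d_gt0 d_le] := eigen_residue_gt0.
(* As [p <= p ^+ k], this choice gives [2 * e * ell1 b < d] for [e] the inverse of [p ^+ k]; scaling
   by [p] then undoes [e] without roots. *)
pose p := (Num.bound (2 * ell1 b / d)).+1.
have p_gt0 : 0 < p%:R :> R by rewrite ltr0n.
have pP : 2 * ell1 b < d * p%:R.
  have /archi_boundP bound : 0 <= 2 * ell1 b / d
    by rewrite divr_ge0 ?mulr_ge0 ?ell1_ge0 // ltW.
  by rewrite [ltRHS]mulrC -ltr_pdivrMr // (lt_trans bound) // ltr_nat.
pose e : R := (p%:R ^+ k)^-1.
have e_gt0 : 0 < e by rewrite invr_gt0 exprn_gt0.
have [[x xP]|[x Sx xP]] := solution_or_eigenvector (fun i => e * b i).
  exists (p%:R *: x) => i. rewrite F_homog xP mulVKf //.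
  by rewrite gt_eqF // exprn_gt0.
have := d_le x Sx; rewrite leNgt => /negP[].
pose N := ell1 (F^~ x); pose M := ell1 (fun l => F l x - e * b l).
have NM : `|N - M| <= e * ell1 b.
  rewrite -[e in leRHS]gtr0_norm // -ell1Z; apply: le_trans (ell1_dist _ _) _.
  rewrite le_eqVlt; apply/orP; left; apply/eqP/eq_bigr => i _.
  by rewrite opprB addrC subrK.
(* After this substitution both summands have l1-norm at most [e * ell1 b]. *)
have -> : (fun i => F i x + N * x 0 i) = (fun i => e * b i + (N - M) * x 0 i).
  by apply/funext => i; have := xP i; rewrite -/M /= => xPi; lra.
apply: (le_lt_trans (ell1D _ _)); rewrite !ell1Z Sx mulr1 gtr0_norm //.
apply: (le_lt_trans (lerD (lexx _) NM)).
rewrite -mulr2n -mulrnAr -mulr_natl mulrC ltr_pdivrMr ?exprn_gt0 //.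
apply: (lt_le_trans pP); rewrite ler_pM2l // -[leLHS]expr1 ler_weXn2l // ler1n.
by [].
Qed.
End Homogeneous.

(** * Tensor equations as homogeneous systems of degree [m.-1] *)

Theorem corollary3p1 (R : realType) (m n : nat) (hm : (2 <= m)%N)
    (hn : (1 <= n)%N) (A : tensor R m n) (hA : Zplus_tensor A) :
  forall b : 'cV[R]_n, exists x : 'cV[R]_n, tensor_apply A x = b.
Proof.
move=> b; pose F i (y : 'rV[R]_n) := tensor_apply A y^T i 0.
have [||||x xP] := @homogeneous_surjective R n m.-1 F _ _ _ _ (b^~ 0).
- move=> i; rewrite /F; under eq_fun do rewrite mxE.
  have coord_prod (s : seq 'I_n) : continuous (fun y : 'rV[R]_n => \prod_(j <- s) y^T j 0).
    apply: continuous_prod => j; under eq_fun do rewrite mxE; exact: coord_continuous.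
  by apply: continuous_sum => s x; apply: (cvgM (cvg_cst (A s)) (@coord_prod _ x)).
- move=> x t x0 t0 Fx; apply: hA; exists x^T, t; split=> //.
    by rewrite -trmx0 (inj_eq trmx_inj).
  by apply/colP => i; rewrite !mxE -[RHS](Fx i) /F !mxE.
- by case: m hm {A hA F} => [|[]].
- move=> c x i; rewrite /F !mxE mulr_sumr; apply: eq_bigr => s _.
  rewrite mulrCA; congr (_ * _).
  under eq_bigr do rewrite !mxE; rewrite big_split /=; congr (_ * _); last first.
    by apply: eq_bigr => j _; rewrite mxE.
  by rewrite big_const_seq count_predT iter_mulr_1 size_behead size_tuple.
by exists x^T; apply/colP => i; exact: xP.
Qed.
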